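(* Let $A$ be an object of $\mathbf{Std}_{Cvx}$, and let $\mathbb{E}_{\bullet}(id_A):\mathcal{G}A\to A$ be the unique affine measurable map such that $m(\mathbb{E}_P(id_A))=\int_A m\,dP$ for all $P\in\mathcal{G}A$ and all affine measurable $m:A\to\mathbb{R}_\infty$. Then $\mathbb{E}_{\bullet}(id_A)$ is a $\mathcal{G}$-algebra, where $\mathcal{G}$ is the Giry monad on standard Borel spaces.
   Context: The Giry monad $\mathcal{G}$ on the category $\mathbf{Std}$ of standard Borel spaces and measurable functions: $\mathcal{G}X$ is the set of probability measures on $X$ with the smallest $\sigma$-algebra making all evaluations $ev_U(P)=P(U)$ ($U$ measurable) measurable; $\mathcal{G}f$ is pushforward; the unit is $\eta_X(x)=\delta_x$ and the multiplication is $\mu_X(Q)[U]=\int_{P\in\mathcal{G}X}P(U)\,dQ$. A $\mathcal{G}$-algebra is a measurable $h:\mathcal{G}X\to X$ with $h\circ\eta_X=id_X$ and $h\circ\mu_X=h\circ\mathcal{G}h$. A convex space is a set with operations $(a_i)_{i=1}^n\mapsto\sum_{i=1}^n p_ia_i$ for all $n$ and all $p_i\in[0,1]$ with $\sum p_i=1$, satisfying the usual unit and associativity axioms (an algebra of the finitely supported distribution monad); affine maps preserve these operations. $\mathcal{G}X$ is a convex space with pointwise structure $(\sum p_iP_i)(U)=\sum p_iP_i(U)$. $\mathbb{R}_\infty=\mathbb{R}\cup\{\infty\}$ is the one-point compactification of $\mathbb{R}$ with its Borel $\sigma$-algebra, with the usual convex structure on $\mathbb{R}$ and a convex combination being $\infty$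 whenever $\infty$ occurs with positive weight. For $f:X\to\mathbb{R}_\infty$ measurable and $P\in\mathcal{G}X$, $\tilde P(f)=\int_X f\,dP\in\mathbb{R}_\infty$ is the Lebesgue integral, with $\infty\cdot 0=0$; it equals $\infty$ if $P(f^{-1}(\infty))>0$ and also if $f$ is $P$-a.e. finite but not integrable. $\mathbf{Std}\cap\mathbf{Cvx}$ is the category whose objects are standard Borel spaces equipped with a convex space structure and whose morphisms are affine measurable functions. $\mathbf{Std}_{Cvx}$ is its full subcategory of objects $A$ satisfying the fullness property: for all $P\in\mathcal{G}A$, the set $\bigcap_m m^{-1}(\tilde P(m))=\{a\in A\mid \tilde P(m)=m(a)\ \forall m\}$ is nonempty, where $m$ ranges over all affine measurable functions $A\to\mathbb{R}_\infty$. The existence and uniqueness of $\mathbb{E}_{\bullet}(id_A)$ is a separate lemma of the paper.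
   Formalization: The map is assumed unique among all measurable maps (not only affine ones) with the integral property, since uniqueness among affine measurable maps does not suffice when affine measurable maps to R_∞ fail to separate points of A; A is taken nonempty. *)

(* Defs.v *)
From HB Require Import structures.
From mathcomp Require Import all_boot all_order all_algebra.
From mathcomp Require Import all_classical all_reals all_analysis.
From mathcomp Require Import measurable_realfun.

Set Implicit Arguments.
Unset Strict Implicit.
Unset Printing Implicit Defensive.

Import Order.TTheory GRing.Theory Num.Theory.
Import numFieldNormedType.Exports.

Local Open Scope classical_set_scope.
Local Open Scope ring_scope.

Record simplex (R : realType) (n : nat) := Simplex {
  weight :> 'I_n -> R ;
  weight_ge0 : forall i, 0 <= weight i ;
  weight_sum1 : \sum_i weight i = 1 }.

Section simplex_ops.
Context (R : realType).

Lemma simplex_delta_ge0 n (j i : 'I_n) : 0 <= (i == j)%:R :> R.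
Proof. exact: ler0n. Qed.

Lemma simplex_delta_sum1 n (j : 'I_n) : \sum_i (i == j)%:R = 1 :> R.
Proof.
rewrite (bigD1 j)//= eqxx big1 ?addr0// => i /negPf ->.
by [].
Qed.

Definition simplex_delta n (j : 'I_n) : simplex R n :=
  Simplex (simplex_delta_ge0 j) (simplex_delta_sum1 j).

Variables (m n : nat) (p : simplex R m) (q : 'I_m -> simplex R n).

Lemma simplex_comp_ge0 k : 0 <= \sum_i p i * q i k.
Proof. by apply: sumr_ge0 => i _; rewrite mulr_ge0// weight_ge0. Qed.

Lemma simplex_comp_sum1 : \sum_k \sum_i p i * q i k = 1.
Proof.
rewrite exchange_big/= -[RHS](weight_sum1 p); apply: eq_bigr => i _.
by rewrite -mulr_sumr weight_sum1 mulr1.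
Qed.

Definition simplex_comp : simplex R n :=
  Simplex simplex_comp_ge0 simplex_comp_sum1.

End simplex_ops.

(* [conv n p a] is the convex combination \sum_i p_i a_i. The two axioms say
   exactly that [conv] is an algebra of the finitely supported distribution
   monad; invariance under permuting or merging the indices follows from them. *)
Record convexStructure (R : realType) (A : Type) := ConvexStructure {
  conv : forall n, simplex R n -> ('I_n -> A) -> A ;
  conv_unit : forall n (a : 'I_n -> A) j, conv (simplex_delta R j) a = a j ;
  conv_assoc : forall m n (p : simplex R m) (q : 'I_m -> simplex R n)
      (a : 'I_n -> A),
    conv p (fun i => conv (q i) a) = conv (simplex_comp p q) a }.

Definition affine (R : realType) (A B : Type)
    (cA : convexStructure R A) (cB : convexStructure R B) (f : A -> B) :=
  forall n (p : simplex R n) (a : 'I_n -> A),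
    f (conv cA p a) = conv cB p (fun i => f (a i)).

(* The carrier is [option R], and [None] is the point at infinity. *)
Definition Rinf (R : realType) : measurableType _ :=
  g_sigma_algebraType (@open (one_point_compactification R)).

Definition Rinf_fin (R : realType) (x : Rinf R) : R :=
  odflt 0 (x : option R).

Definition Rinf_conv (R : realType) n (p : simplex R n) (a : 'I_n -> Rinf R)
    : Rinf R :=
  if [exists i, (0 < p i) && (a i == None)] then None
  else Some (\sum_i p i * Rinf_fin (a i)).

Section Rinf_convex.
Context (R : realType).

Lemma Rinf_conv_unit n (a : 'I_n -> Rinf R) j :
  Rinf_conv (simplex_delta R j) a = a j.
Proof.
rewrite /Rinf_conv; case: ifPn => [/existsP[i]|].
  rewrite /=; have [->|_] := eqVneq i j; last by rewrite ltxx.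
  by move=> /andP[_ /eqP ->].
rewrite negb_exists => /forallP/(_ j); rewrite /= eqxx ltr01/=.
rewrite (bigD1 j)//= eqxx mul1r big1 ?addr0; last first.
  by move=> i /negPf ->; rewrite mul0r.
by rewrite /Rinf_fin; case: (a j).
Qed.

Lemma Rinf_conv_assoc m n (p : simplex R m) (q : 'I_m -> simplex R n)
    (a : 'I_n -> Rinf R) :
  Rinf_conv p (fun i => Rinf_conv (q i) a) = Rinf_conv (simplex_comp p q) a.
Proof.
have pq k : (0 < simplex_comp p q k) = [exists i, (0 < p i) && (0 < q i k)].
  apply/idP/existsP => [|[i /andP[pi qi]]]; last first.
    rewrite /= (bigD1 i)//= ltr_pwDl ?mulr_gt0//.
    by apply: sumr_ge0 => l _; rewrite mulr_ge0// weight_ge0.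
  apply: contraPP => /forallNP H /=; rewrite big1 ?ltxx// => i _.
  move: (H i) => /negP; rewrite !lt_def !weight_ge0 !andbT negb_and !negbK.
  by move=> /orP[/eqP->|/eqP->]; rewrite ?mul0r ?mulr0.
rewrite {1 3}/Rinf_conv.
have -> : [exists i, (0 < p i) && (Rinf_conv (q i) a == None)] =
          [exists k, (0 < simplex_comp p q k) && (a k == None)].
  apply/existsP/existsP => [[i /andP[pi]]|[k /andP[]]].
    rewrite /Rinf_conv; case: ifPn => // /existsP[k /andP[qk ak]] _.
    by exists k; rewrite ak andbT pq; apply/existsP; exists i; rewrite pi.
  rewrite pq => /existsP[i /andP[pi qk]] ak; exists i; rewrite pi/= /Rinf_conv.
  by rewrite (_ : [exists _, _])//; apply/existsP; exists k; rewrite qk.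
case: ifPn => // /existsPn H; congr Some.
transitivity (\sum_i \sum_k p i * (q i k * Rinf_fin (a k))).
  apply: eq_bigr => i _; rewrite -mulr_sumr.
  have := weight_ge0 p i; rewrite le_eqVlt => /predU1P[<-|pi].
    by rewrite !mul0r.
  congr (_ * _); rewrite /Rinf_conv; case: ifPn => // /existsP[k /andP[qk ak]].
  move: (H k); rewrite ak andbT pq => /negP; elim.
  by apply/existsP; exists i; rewrite pi.
rewrite exchange_big/=; apply: eq_bigr => k _; rewrite mulr_suml.
by apply: eq_bigr => i _; rewrite mulrA.
Qed.

Definition Rinf_convex : convexStructure R (Rinf R) :=
  ConvexStructure Rinf_conv_unit Rinf_conv_assoc.

End Rinf_convex.

(* [None] as soon as [m] takes the value [None] with positive probability, or
   is almost surely finite but not integrable. Otherwise the value 0 given to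
   [m] on the negligible set [m @^-1` [set None]] is harmless. *)
Definition Rinf_integral (R : realType) d (A : measurableType d)
    (P : probability A R) (m : A -> Rinf R) : Rinf R :=
  if `[< P (m @^-1` [set None]) = 0%E /\
         P.-integrable [set: A] (fun x => (Rinf_fin (m x))%:E) >]
  then Some (Rintegral P [set: A] (fun x => Rinf_fin (m x)))
  else None.

Definition standard_borel (R : realType) d (A : measurableType d) :=
  exists X : completePseudoMetricType R,
    [/\ hausdorff_space X, @second_countable X &
      exists f : A -> X, bijective f /\
        forall U : set A, measurable U <-> <<s @open X >> (f @` U)].

(* A [probability A R] is a function on all subsets of [A], so that elements of
   [pprobability A R] may differ on non-measurable sets only. The sigma-algebra
   does not separate such elements, hence a measurable function from
   [pprobability A R] to a standard Borel space identifies them. *)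

Section giry_mul.
Context (R : realType) d (A : measurableType d).
Variable Q : probability (pprobability A R) R.

Definition giry_mul_fun (U : set A) : \bar R :=
  (\int[Q]_(P in [set: pprobability A R]) (P : probability A R) U)%E.

Local Open Scope ereal_scope.

Lemma measurable_ev (U : set A) : measurable U ->
  measurable_fun [set: pprobability A R]
    (fun P : pprobability A R => (P : probability A R) U).
Proof.
move=> mU.
exact: (measurable_kernel (kprobability (@measurable_id _ _ [set: pprobability A R])) U mU).
Qed.

Let giry_mul0 : giry_mul_fun set0 = 0.
Proof. by rewrite /giry_mul_fun integral0_eq. Qed.

Let giry_mul_ge0 U : 0 <= giry_mul_fun U.
Proof. by apply: integral_ge0 => P _; exact: measure_ge0. Qed.

Let giry_mul_sigma_additive : semi_sigma_additive giry_mul_fun.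
Proof.
move=> F mF tF mUF; rewrite /giry_mul_fun.
rewrite [X in _ --> X](_ : _ =
    \int[Q]_(P in [set: pprobability A R])
      (\sum_(0 <= k <oo) (P : probability A R) (F k))); last first.
  apply: eq_integral => P _.
  by apply/esym/cvg_lim => //; exact: measure_semi_sigma_additive.
rewrite integral_nneseries//; last by move=> n; exact: measurable_ev.
by apply: is_cvg_nneseries => n _ _; exact: giry_mul_ge0.
Qed.

HB.instance Definition _ := isMeasure.Build _ _ _ giry_mul_fun
  giry_mul0 giry_mul_ge0 giry_mul_sigma_additive.

Let giry_mul_setT : giry_mul_fun [set: A] = 1.
Proof.
rewrite /giry_mul_fun; under eq_integral do rewrite probability_setT.
by rewrite integral_cst// mul1e; exact: probability_setT.
Qed.

HB.instance Definition _ := Measure_isProbability.Build _ _ _ giry_mul_fun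
  giry_mul_setT.

Definition giry_mul : pprobability A R := giry_mul_fun.

End giry_mul.

Definition giry_unit (R : realType) d (A : measurableType d) (a : A)
    : pprobability A R := dirac a.

Definition giry_fmap (R : realType) d d' (A : measurableType d)
    (B : measurableType d') (f : {mfun A >-> B}) (P : pprobability A R)
    : pprobability B R := distribution P f.

Definition giry_algebra (R : realType) d (A : measurableType d)
    (h : {mfun pprobability A R >-> A}) :=
  (forall a : A, h (giry_unit R a) = a) /\
  (forall Q : pprobability (pprobability A R) R,
     h (giry_mul Q) = h (giry_fmap h Q)).

Section giry_convex.
Context (R : realType) d (A : measurableType d).

Section giry_conv.
Variables (n : nat) (p : simplex R n) (P : 'I_n -> pprobability A R).

Local Open Scope ereal_scope.

Definition giry_conv_fun (U : set A) : \bar R :=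
  \sum_(i < n) (p i)%:E * (P i : probability A R) U.

Let giry_conv0 : giry_conv_fun set0 = 0.
Proof. by rewrite /giry_conv_fun big1// => i _; rewrite measure0 mule0. Qed.

Let giry_conv_ge0 U : 0 <= giry_conv_fun U.
Proof. by apply: sume_ge0 => i _; rewrite mule_ge0// lee_fin weight_ge0. Qed.

Let giry_conv_sigma_additive : semi_sigma_additive giry_conv_fun.
Proof.
move=> F mF tF mUF; rewrite /giry_conv_fun.
rewrite [X in X @ _ --> _](_ : _ =
    (fun k => \sum_(i < n) (p i)%:E *
       \sum_(0 <= l < k) (P i : probability A R) (F l))); last first.
  apply/funext => k; rewrite exchange_big/=; apply: eq_bigr => i _.
  by rewrite ge0_sume_distrr.
apply: cvg_nnesum => i _.
- by apply: nearW => k; rewrite mule_ge0 ?lee_fin ?weight_ge0// sume_ge0.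
- by apply: cvgeZl => //; exact: measure_semi_sigma_additive.
Qed.

HB.instance Definition _ := isMeasure.Build _ _ _ giry_conv_fun
  giry_conv0 giry_conv_ge0 giry_conv_sigma_additive.

Let giry_conv_setT : giry_conv_fun [set: A] = 1.
Proof.
rewrite /giry_conv_fun; under eq_bigr do rewrite probability_setT mule1.
by rewrite sumEFin weight_sum1.
Qed.

HB.instance Definition _ := Measure_isProbability.Build _ _ _ giry_conv_fun
  giry_conv_setT.

Definition giry_conv : pprobability A R := giry_conv_fun.

End giry_conv.

Lemma giry_ext (P Q : pprobability A R) :
  (forall U, (P : probability A R) U = (Q : probability A R) U) -> P = Q.
Proof.
case: P Q => [P [[a b] [c] [e] [f] [g] [h] [k]]].
case=> [Q [[a' b'] [c'] [e'] [f'] [g'] [h'] [k']]] /= /funext PQ.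
subst Q; rewrite (Prop_irrelevance a' a) (Prop_irrelevance b' b) in c' *.
by rewrite (Prop_irrelevance c' c) (Prop_irrelevance e' e)
  (Prop_irrelevance f' f) (Prop_irrelevance g' g) (Prop_irrelevance h' h)
  (Prop_irrelevance k' k).
Qed.

Lemma giry_conv_unit n (P : 'I_n -> pprobability A R) j :
  giry_conv (simplex_delta R j) P = P j.
Proof.
apply: giry_ext => U.
rewrite /giry_conv/= /giry_conv_fun (bigD1 j)//= eqxx mul1e big1 ?adde0//.
by move=> i /negPf ->; rewrite mul0e.
Qed.

Lemma giry_conv_assoc m n (p : simplex R m) (q : 'I_m -> simplex R n)
    (P : 'I_n -> pprobability A R) :
  giry_conv p (fun i => giry_conv (q i) P) = giry_conv (simplex_comp p q) P.
Proof.
apply: giry_ext => U; rewrite /giry_conv/= /giry_conv_fun/=.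
under eq_bigr => i _.
  rewrite ge0_sume_distrr; last first.
    by move=> k _; rewrite mule_ge0// lee_fin weight_ge0.
  over.
rewrite exchange_big/=; apply: eq_bigr => k _.
rewrite -sumEFin ge0_sume_distrl; last first.
  by move=> i _; rewrite lee_fin mulr_ge0// weight_ge0.
by apply: eq_bigr => i _; rewrite muleA EFinM.
Qed.

Definition giry_convex : convexStructure R (pprobability A R) :=
  ConvexStructure giry_conv_unit giry_conv_assoc.

End giry_convex.

Section barycenter.
Context (R : realType) d (A : measurableType d) (cA : convexStructure R A).

Definition barycenters (P : pprobability A R) : set A :=
  [set a | forall m : {mfun A >-> Rinf R}, affine cA (Rinf_convex R) m ->
     Rinf_integral P m = m a].

Definition fullness := forall P : pprobability A R, barycenters P !=set0.

(* No compatibility between the convex structure and the sigma-algebra of [A]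
   is required, so the morphisms into [Rinf R] need not separate points. If the
   uniqueness clause ranged over affine [E'] only, some [E] satisfying it would
   not be a retraction of the unit; it therefore ranges over measurable [E']. *)
Definition is_expectation (E : {mfun pprobability A R >-> A}) :=
  [/\ affine (giry_convex R A) cA E,
      forall P, barycenters P (E P) &
      forall E' : {mfun pprobability A R >-> A},
        (forall P, barycenters P (E' P)) -> forall P, E' P = E P].

End barycenter.

(* Main.v *)
(* If E P = c, every b in barycenters P is a barycenter of every P' with
   E P' = c, so E may be redefined as b on the measurable fibre of E over c;
   by uniqueness E P = b, i.e. E P is the only barycenter of P. It remains to
   see that a is a barycenter of the Dirac measure at a, and that every
   barycenter of the pushforward of Q along E is one of the mixture of Q. The
   latter is Fubini, once an affine map m that is P-almost surely finite is known
   to be P-integrable; otherwise the iterated integral of m could be finite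
   while its integral against the mixture is infinite. *)
Require Import Defs.
From mathcomp Require Import all_boot all_order all_algebra.
From mathcomp Require Import all_classical all_reals all_analysis.
From mathcomp Require Import measurable_realfun.

Set Implicit Arguments.
Unset Strict Implicit.
Unset Printing Implicit Defensive.

Import Order.TTheory GRing.Theory Num.Theory.
Import numFieldNormedType.Exports.

Local Open Scope classical_set_scope.
Local Open Scope ring_scope.

(** Points of a Hausdorff space are closed. This is what makes the fibres of [E] measurable. *)
Lemma standard_borel_measurable_set1 (R : realType) d (A : measurableType d)
    (a : A) : standard_borel R A -> measurable [set a].
Proof.
move=> [X [hX _ [f [_ fP]]]]; apply/fP; rewrite image_set1 -[[set f a]]setCK.
apply: sigma_algebraC; apply: sub_sigma_algebra; apply: closed_openC.
by apply: accessible_closed_set1; exact: hausdorff_accessible.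
Qed.

(** * Borel sets of the compactified line *)

Section Rinf_measurability.
Context (R : realType).

Lemma measurable_Rinf_Some (U : set R) :
  open U -> measurable (Some @` U : set (Rinf R)).
Proof.
move=> oU; apply: sub_sigma_algebra.
exact: one_point_compactification_open_some.
Qed.

Lemma measurable_Rinf_None : measurable ([set None] : set (Rinf R)).
Proof.
rewrite (_ : [set None] = ~` (Some @` [set: R] : set (Rinf R))).
  by apply: measurableC; apply: measurable_Rinf_Some; exact: openT.
apply/seteqP; split => [_ -> [? _]//|[x []|//]].
by exists x.
Qed.

Lemma measurable_Rinf_fin : measurable_fun [set: Rinf R] (@Rinf_fin R).
Proof.
apply: (measurability _ (RGenOInfty.measurableE R)) => _ [_ [x ->] <-].
rewrite setTI.
(* [Rinf_fin] sends [None] to 0, so infinity lies in the preimage exactly when [x < 0]. *)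
rewrite (_ : _ @^-1` _ = (Some @` [set y | x < y]) `|`
    (if x < 0 then [set None] else set0)).
  apply: measurableU; first by apply: measurable_Rinf_Some; apply: (@open_gt R x).
  by case: ifP => _; [exact: measurable_Rinf_None|exact: measurable0].
apply/seteqP; split => [[y|]|y]; rewrite /= ?in_itv/= ?andbT.
- by move=> xy; left; exists y.
- by move=> ->; right.
- move=> [[z ? <-]//|].
  by case: ifP => // x0 ->.
Qed.

End Rinf_measurability.

(** * Integrals with values in the compactified line *)

Section Rinf_integral_theory.
Context (R : realType) d (A : measurableType d).
Implicit Types (m : {mfun A >-> Rinf R}) (P : probability A R).

Lemma measurable_Rinf_infty m : measurable (m @^-1` [set None]).
Proof.
rewrite -[X in measurable X]setTI.
by apply: (measurable_funP m) => //; exact: measurable_Rinf_None.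
Qed.

Lemma measurable_EFin_Rinf m :
  measurable_fun [set: A] (fun x => (Rinf_fin (m x))%:E).
Proof.
apply/measurable_EFinP.
exact: measurableT_comp (@measurable_Rinf_fin R) (measurable_funP m).
Qed.

Lemma Rinf_integral_NoneP P m : Rinf_integral P m <> None <->
  P (m @^-1` [set None]) = 0%E /\
  P.-integrable [set: A] (fun x => (Rinf_fin (m x))%:E).
Proof. by rewrite /Rinf_integral; case: asboolP. Qed.

(** If [m a] is infinite, the set where [m] is infinite has mass 1. Otherwise [m] is integrable, its
    absolute value having the finite integral [|m a|]. *)
Lemma Rinf_integral_dirac m (a : A) : Rinf_integral (dirac a) m = m a.
Proof.
set P : probability A R := dirac a.
have intP f : measurable_fun [set: A] f -> (\int[P]_x f x = f a)%E.
  by move=> mf; rewrite [LHS]integral_dirac// diracT mul1e.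
have PN : P (m @^-1` [set None]) = ((m a == None)%:R%:E : \bar R).
  by rewrite [LHS]diracE; case: eqP => ?; [rewrite mem_set|rewrite memNset].
have mm := measurable_EFin_Rinf m.
rewrite /Rinf_integral /Rintegral PN intP//.
case: asboolP => [[]|]; first by case: (m a) => //= /eqP; rewrite eqe oner_eq0.
case: (m a) => [r nint|//]; exfalso; apply: nint; split => //.
apply/integrableP; split => //; rewrite intP ?ltry//.
exact: measurableT_comp.
Qed.

End Rinf_integral_theory.

(** * Fubini for mixtures *)

Section giry_mul_integral.
Local Open Scope ereal_scope.
Context (R : realType) d (A : measurableType d).
Variable Q : pprobability (pprobability A R) R.

Lemma ge0_measurable_giry_integral (f : A -> \bar R) :
  (forall x, 0 <= f x) -> measurable_fun [set: A] f ->
  measurable_fun [set: pprobability A R]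
    (fun P : pprobability A R => \int[(P : probability A R)]_x f x).
Proof.
move=> f0 mf.
apply: (@measurable_fun_integral_kernel _ _ (pprobability A R) A R
  (fun P => (P : probability A R))) => // U mU.
exact: measurable_ev.
Qed.

Lemma measurable_giry_integral (f : A -> \bar R) :
  measurable_fun [set: A] f ->
  measurable_fun [set: pprobability A R]
    (fun P : pprobability A R => \int[(P : probability A R)]_x f x).
Proof.
move=> mf; under eq_fun do rewrite integralE.
apply: emeasurable_funB; apply: ge0_measurable_giry_integral => //.
- exact: measurable_funepos.
- exact: measurable_funeneg.
Qed.

Lemma ge0_integral_giry_mul (f : A -> \bar R) :
  (forall x, 0 <= f x) -> measurable_fun [set: A] f ->
  \int[(giry_mul Q : probability A R)]_x f x =
  \int[Q]_P \int[(P : probability A R)]_x f x.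
Proof.
move=> f0 mf.
(* The mixture is a composite of kernels: the constant kernel [Q] on [unit], then the kernel that
   sends [P] to the measure [P]. *)
exact: (@integral_kcomp _ _ _ unit (pprobability A R) A R
  (kprobability (measurable_cst Q)) (kprobability measurable_snd) tt f f0 mf).
Qed.

Lemma integral_giry_mul (f : A -> \bar R) :
  (giry_mul Q : probability A R).-integrable [set: A] f ->
  \int[(giry_mul Q : probability A R)]_x f x =
  \int[Q]_P \int[(P : probability A R)]_x f x.
Proof.
move=> intf.
have mf : measurable_fun [set: A] f by case/integrableP : intf.
have mfp := measurable_funepos mf.
have mfn := measurable_funeneg mf.
(* Both iterated integrals, of the positive and of the negative part, must be finite before they can
   be subtracted under the integral over [Q]. *)
have intF g : (forall x, 0 <= g x) ->
    (giry_mul Q : probability A R).-integrable [set: A] g ->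
    Q.-integrable [set: pprobability A R]
      (fun P => \int[(P : probability A R)]_x g x).
  move=> g0 intg; have mg : measurable_fun [set: A] g by case/integrableP : intg.
  apply/integrableP; split; first exact: measurable_giry_integral.
  under eq_integral do rewrite gee0_abs ?integral_ge0//.
  by rewrite -ge0_integral_giry_mul//; exact: integrable_lty.
rewrite integralE !ge0_integral_giry_mul// -integralB//; last 2 first.
  by apply: intF => //; exact: integrable_funepos.
  by apply: intF => //; exact: integrable_funeneg.
by apply: eq_integral => P _; rewrite [RHS]integralE.
Qed.

End giry_mul_integral.

(** * Barycenters: integrability, uniqueness, mixtures *)

Section barycenter_theory.
Context (R : realType) d (A : measurableType d) (cA : convexStructure R A).

Definition Rinf_zero_fin (x : Rinf R) : Rinf R :=
  if x is Some _ then Some 0 else None.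

Lemma measurable_Rinf_zero_fin : measurable_fun [set: Rinf R] Rinf_zero_fin.
Proof.
have -> : Rinf_zero_fin = fun x : Rinf R =>
    if x \in [set None] then None else Some 0 : Rinf R.
  by apply/funext => -[r|]; [rewrite memNset|rewrite mem_set].
apply: measurable_fun_ifT => //.
apply: (measurable_fun_bool true); rewrite setTI.
rewrite (_ : _ @^-1` _ = [set None]); first exact: measurable_Rinf_None.
by apply/seteqP; split => x; [exact: set_mem|exact: mem_set].
Qed.

(** Whether a combination is infinite depends only on which entries are infinite, and a combination
    of zeros is zero. *)
Lemma affine_Rinf_zero_fin : affine (Rinf_convex R) (Rinf_convex R) Rinf_zero_fin.
Proof.
move=> n p a /=; rewrite /Rinf_conv.
have -> : [exists i, (0 < p i) && (Rinf_zero_fin (a i) == None)] =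
    [exists i, (0 < p i) && (a i == None)].
  by apply: eq_existsb => i; case: (a i).
case: ifP => //= _; congr Some; rewrite big1// => i _.
by case: (a i) => [?|] /=; rewrite mulr0.
Qed.

(* If [m] were almost surely finite but not integrable, a barycenter [a] of [P]
   would have [m a = None]; but [Rinf_zero_fin \o m] is affine too, with
   integral [Some 0], which forces [m a] to be finite. *)
Lemma full_integrable (P : pprobability A R) (m : {mfun A >-> Rinf R}) :
  barycenters cA P !=set0 -> affine cA (Rinf_convex R) m ->
  (P : probability A R) (m @^-1` [set None]) = 0%E ->
  (P : probability A R).-integrable [set: A] (fun x => (Rinf_fin (m x))%:E).
Proof.
move=> [a Pa] am Pm0.
have mk : measurable_fun [set: A] (Rinf_zero_fin \o m).
  exact: measurableT_comp measurable_Rinf_zero_fin (measurable_funP m).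
pose k : {mfun A >-> Rinf R} := mfun_Sub (mem_set mk).
have ka : Rinf_integral P k = k a.
  apply: Pa => n p x; rewrite /= am.
  exact: affine_Rinf_zero_fin.
have kN : Rinf_integral P k <> None.
  apply/Rinf_integral_NoneP; split.
    rewrite -[RHS]Pm0; congr (_ _); apply/seteqP.
    by split => x /=; case: (m x).
  rewrite (_ : (fun _ => _) = cst 0%E); first exact: integrable0.
  by apply/funext => x /=; case: (m x).
suff : Rinf_integral P m <> None by move/Rinf_integral_NoneP => [].
rewrite Pa// => ma0; apply: kN.
by rewrite ka /= ma0.
Qed.

Lemma expectation_unique (E : {mfun pprobability A R >-> A})
    (P : pprobability A R) (b : A) :
  measurable [set E P] -> is_expectation cA E -> barycenters cA P b -> E P = b.
Proof.
move=> mEP [_ bE uE] Pb.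
pose f (Q : pprobability A R) := if E Q \in [set E P] then b else E Q.
have mf : measurable_fun [set: pprobability A R] f.
  apply: measurable_fun_ifT => //; apply: (measurable_fun_bool true).
  rewrite (_ : _ @^-1` _ = E @^-1` [set E P]).
    by apply: (measurable_funP E).
  by apply/seteqP; split => Q; [exact: set_mem|exact: mem_set].
pose E' : {mfun pprobability A R >-> A} := mfun_Sub (mem_set mf).
rewrite -(uE E').
  by rewrite /= /f mem_set.
move=> Q; rewrite /= /f; case: ifPn => [|_]; last exact: bE.
(* On the fibre, [Q] and [P] give every affine [m] the same integral, namely [m (E P)], so [b] is a
   barycenter of [Q] too. *)
rewrite in_setE /= => EQ m am.
by rewrite (bE Q m am) EQ -(bE P m am) Pb.
Qed.

Lemma barycenters_giry_unit (a : A) : barycenters cA (giry_unit R a) a.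
Proof. by move=> m _; exact: Rinf_integral_dirac. Qed.

Lemma barycenters_giry_mul (E : {mfun pprobability A R >-> A})
    (Q : pprobability (pprobability A R) R) (b : A) :
  fullness cA ->
  (forall P, barycenters cA P (E P)) ->
  barycenters cA (giry_fmap E Q) b -> barycenters cA (giry_mul Q) b.
Proof.
move=> full bE bb m am; rewrite -(bb m am).
set N := m @^-1` [set None].
have mN : measurable N := measurable_Rinf_infty m.
have mm := measurable_EFin_Rinf m.
(* Fullness rules out the other source of an infinite integral, namely [m] almost surely finite but
   not integrable. *)
have EN P : m (E P) = None <-> (P : probability A R) N <> 0%E.
  rewrite -(bE P m am); split => [+ PN|PN].
    by apply/Rinf_integral_NoneP; split => //; exact: full_integrable.
  by apply: contrapT => /Rinf_integral_NoneP[].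
have mev := measurable_ev (R := R) mN.
have ev0 (P : pprobability A R) : (0 <= (P : probability A R) N)%E.
  exact: measure_ge0.
have muN : (giry_mul Q : probability A R) N = 0%E <->
    ae_eq Q [set: pprobability A R] (fun P => (P : probability A R) N) (cst 0%E).
  apply: iff_trans _ (ae_eq_integral_abs Q measurableT mev).
  rewrite [X in X = _ <-> _](_ : _ =
    (\int[Q]_P `| (P : probability A R) N |)%E)//.
  by apply: eq_integral => P _; rewrite gee0_abs.
have EQN : (giry_fmap E Q : probability A R) N = 0%E <->
    ae_eq Q [set: pprobability A R] (fun P => (P : probability A R) N) (cst 0%E).
  have mEN : measurable (E @^-1` N).
    by rewrite -[X in measurable X]setTI; apply: (measurable_funP E).
  rewrite [X in X = _ <-> _](_ : _ = (Q : probability _ _) (E @^-1` N))//.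
  rewrite -(negligibleP _ mEN).
  rewrite (_ : E @^-1` N = ~` [set P | setT P -> (P : probability A R) N = 0%E])//.
  apply/seteqP; split => P /=.
    by move=> /EN + PN; apply; exact: PN.
  by move=> PN; apply/EN => PN0; exact: PN.
(* The mixture and the pushforward neglect [N] under the same condition on [Q], so both integrals of
   [m] are infinite or neither is. *)
have [N0|N0] := pselect ((giry_mul Q : probability A R) N = 0%E); last first.
  rewrite /Rinf_integral !asboolF// => -[N0'] _; last exact: N0.
  exact/N0/muN/EQN.
have aeN := muN.1 N0.
have EQN0 := EQN.2 aeN.
have imu := full_integrable (full _) am N0.
have iEQ := full_integrable (full _) am EQN0.
rewrite /Rinf_integral !asboolT//; congr Some; congr fine.
rewrite integral_giry_mul// [RHS]integral_distribution//; last first.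
  apply/integrableP; split; first exact: measurableT_comp.
  case/integrableP : iEQ => _.
  by rewrite ge0_integral_distribution//; exact: measurableT_comp.
(* The integrands agree only almost everywhere: where [P] charges [N], [m (E P)] is [None] and
   [Rinf_fin] returns the default 0. *)
apply: ae_eq_integral => //.
- exact: measurable_giry_integral.
- exact: measurableT_comp.
apply: filterS aeN => P PN _.
have PN0 : (P : probability A R) N = 0%E by exact: PN.
have iP := full_integrable (full P) am PN0.
rewrite /= -(bE P m am) /Rinf_integral asboolT//= /Rintegral fineK//.
exact: integrable_fin_num.
Qed.

End barycenter_theory.

Theorem lemma10 (R : realType) (d : measure_display) (A : measurableType d)
    (cA : convexStructure R A)
    (A_std : standard_borel R A) (A_full : fullness cA)
    (E : {mfun pprobability A R >-> A}) (hE : is_expectation cA E) :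
  giry_algebra E.
Proof.
have mA (a : A) : measurable [set a].
  exact: standard_borel_measurable_set1 A_std.
have bE P : barycenters cA P (E P) by case: hE.
split => [a|Q].
  by apply: (expectation_unique _ hE) => //; exact: barycenters_giry_unit.
apply: (expectation_unique _ hE) => //.
exact: barycenters_giry_mul A_full bE (bE _).
Qed.
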